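(* Let $R$ be a unital ring. For every Sylvester module rank function $\dim$ for $R$ there exists a unique bivariant Sylvester module rank function $\dim(\cdot|\cdot)$ for $R$ that extends it, i.e. such that $\dim(\mathcal{M}|\mathcal{M})=\dim(\mathcal{M})$ for every finitely presented left $R$-module $\mathcal{M}$.
   Context: All modules are left modules. A Sylvester module rank function for $R$ is an $\mathbb{R}_{\ge 0}$-valued function $\dim$ on the class of all finitely presented $R$-modules such that: (1) $\dim(0)=0$, $\dim(R)=1$; (2) $\dim(\mathcal{M}_1\oplus\mathcal{M}_2)=\dim(\mathcal{M}_1)+\dim(\mathcal{M}_2)$; (3) for any exact sequence $\mathcal{M}_1\to\mathcal{M}_2\to\mathcal{M}_3\to 0$ one has $\dim(\mathcal{M}_3)\le\dim(\mathcal{M}_2)\le\dim(\mathcal{M}_1)+\dim(\mathcal{M}_3)$. A bivariant Sylvester module rank function for $R$ is an $\mathbb{R}_{\ge 0}\cup\{+\infty\}$-valued function $(\mathcal{M}_1,\mathcal{M}_2)\mapsto\dim(\mathcal{M}_1|\mathcal{M}_2)$ on the class of all pairs of $R$-modules $\mathcal{M}_1\subseteq\mathcal{M}_2$ ($\mathcal{M}_1$ a submodule of $\mathcal{M}_2$) such that: (1) $\dim(\mathcal{M}_1|\mathcal{M}_2)$ is an isomorphism invariant of the pair; (2) writing $\dim(\mathcal{M}):=\dim(\mathcal{M}|\mathcal{M})$, one has $\dim(0)=0$ and $\dim(R)=1$; (3) $\dim(\mathcal{M}_1\oplus\mathcal{M}_3|\mathcal{M}_2\oplus\mathcal{M}_4)=\dim(\mathcal{M}_1|\mathcal{M}_2)+\dim(\mathcal{M}_3|\mathcal{M}_4)$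 for all $\mathcal{M}_1\subseteq\mathcal{M}_2$, $\mathcal{M}_3\subseteq\mathcal{M}_4$; (4) $\dim(\mathcal{M}_1|\mathcal{M}_2)=\sup_{\mathcal{M}_1'}\dim(\mathcal{M}_1'|\mathcal{M}_2)$, with $\mathcal{M}_1'$ ranging over all finitely generated submodules of $\mathcal{M}_1$; (5) if $\mathcal{M}_1$ is finitely generated, $\dim(\mathcal{M}_1|\mathcal{M}_2)=\inf_{\mathcal{M}_2'}\dim(\mathcal{M}_1|\mathcal{M}_2')$, with $\mathcal{M}_2'$ ranging over all finitely generated submodules of $\mathcal{M}_2$ containing $\mathcal{M}_1$; (6) $\dim(\mathcal{M}_2)=\dim(\mathcal{M}_1|\mathcal{M}_2)+\dim(\mathcal{M}_2/\mathcal{M}_1)$ for all $\mathcal{M}_1\subseteq\mathcal{M}_2$. *)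

(* Defs.v *)
From HB Require Import structures.
From mathcomp Require Import all_boot all_order all_algebra.
From mathcomp Require Import all_classical all_reals ereal.

Set Implicit Arguments.
Unset Strict Implicit.
Unset Printing Implicit Defensive.

Import Order.TTheory GRing.Theory Num.Theory.
Local Open Scope ring_scope.

(* A submodule of M is an S : submodClosed M. Membership is boolean, which is
   no restriction in the presence of the axioms of mathcomp.classical.boolp:
   every Prop-valued submodule is of this form through asbool. *)

Section Submodules.
Variables (R : pzRingType) (M : lmodType R).

Definition submodT : {pred M} := xpredT.

Fact submodT_closed : submod_closed submodT. Proof. by []. Qed.

HB.instance Definition _ := GRing.isSubmodClosed.Build R M submodT submodT_closed.

Variable S : submodClosed M.

Definition submod : Type := {x : M | x \in S}.

HB.instance Definition _ := SubChoice.on submod.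
HB.instance Definition _ := [SubChoice_isSubLmodule of submod by <:].

Definition submod_pred : {pred M} := [pred x | x \in S].

Fact submod_pred_zmod_closed : zmod_closed submod_pred.
Proof.
split=> [|x y]; rewrite !inE; first exact: rpred0.
by move=> xS yS; rewrite rpredD// -scaleN1r rpredZ.
Qed.

HB.instance Definition _ :=
  GRing.isZmodClosed.Build M submod_pred submod_pred_zmod_closed.

(* M / S: the library's quotient of abelian groups, here given the induced
   scalar multiplication. *)
Definition quotmod : Type := Quotient.quot submod_pred.

HB.instance Definition _ := GRing.Zmodule.on quotmod.

Definition quotmod_proj (x : M) : quotmod := (\pi_(Quotient.quot submod_pred) x)%qT.

Definition quotmod_scale (a : R) (u : quotmod) : quotmod :=
  quotmod_proj (a *: repr (u : Quotient.quot submod_pred)).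

Fact quotmod_projK (u : quotmod) :
  quotmod_proj (repr (u : Quotient.quot submod_pred)) = u.
Proof. exact: reprK. Qed.

Fact quotmod_eq (x y : M) : (x - y \in S) = (quotmod_proj x == quotmod_proj y).
Proof. exact: (@Quotient.idealrBE M submod_pred). Qed.

Fact quotmod_projD : {morph quotmod_proj : x y / x + y}.
Proof. by move=> x y; rewrite /quotmod_proj; exact: raddfD. Qed.

Fact quotmod_projZ a x : quotmod_scale a (quotmod_proj x) = quotmod_proj (a *: x).
Proof.
by apply/eqP; rewrite -quotmod_eq -scalerBr rpredZ// quotmod_eq quotmod_projK.
Qed.

Fact quotmod_scaleA a b u :
  quotmod_scale a (quotmod_scale b u) = quotmod_scale (a * b) u.
Proof. by rewrite -[u]quotmod_projK !quotmod_projZ scalerA. Qed.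

Fact quotmod_scale1 : left_id 1 quotmod_scale.
Proof. by move=> u; rewrite -[u]quotmod_projK quotmod_projZ scale1r. Qed.

Fact quotmod_scaleDr : right_distributive quotmod_scale +%R.
Proof.
move=> a u v; rewrite -[u]quotmod_projK -[v]quotmod_projK.
by rewrite -quotmod_projD !quotmod_projZ -quotmod_projD scalerDr.
Qed.

Fact quotmod_scaleDl u : {morph quotmod_scale^~ u : a b / a + b}.
Proof.
move=> a b; rewrite -[u]quotmod_projK.
by rewrite !quotmod_projZ -quotmod_projD scalerDl.
Qed.

HB.instance Definition _ := GRing.Zmodule_isLmodule.Build R quotmod
  quotmod_scaleA quotmod_scale1 quotmod_scaleDr quotmod_scaleDl.

End Submodules.

(* S :&: T as a submodule of T; this is S itself when S is contained in T. *)
Definition submod_in (R : pzRingType) (M : lmodType R) (S T : submodClosed M) :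
  {pred submod T} := [pred x | val x \in S].
Arguments submod_in {R M} S T.

Fact submod_in_closed (R : pzRingType) (M : lmodType R) (S T : submodClosed M) :
  submod_closed (submod_in S T).
Proof.
split=> [|a x y]; rewrite !inE; first by rewrite raddf0 rpred0.
by move=> xS yS; rewrite linearD linearZ rpredD ?rpredZ.
Qed.

HB.instance Definition _ (R : pzRingType) (M : lmodType R) (S T : submodClosed M) :=
  GRing.isSubmodClosed.Build R (submod T) (submod_in S T)
    (submod_in_closed S T).

Definition submod_prod (R : pzRingType) (M N : lmodType R)
    (S : submodClosed M) (T : submodClosed N) : {pred (M * N)%type} :=
  [pred u | (u.1 \in S) && (u.2 \in T)].
Arguments submod_prod {R M N} S T.

Fact submod_prod_closed (R : pzRingType) (M N : lmodType R)
    (S : submodClosed M) (T : submodClosed N) :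
  submod_closed (submod_prod S T).
Proof.
split=> [|a u v]; rewrite !inE ?rpred0//.
by move=> /andP[? ?] /andP[? ?]; rewrite !rpredD ?rpredZ.
Qed.

HB.instance Definition _ (R : pzRingType) (M N : lmodType R)
    (S : submodClosed M) (T : submodClosed N) :=
  GRing.isSubmodClosed.Build R (M * N)%type (submod_prod S T)
    (submod_prod_closed S T).

Section Finiteness.
Variable R : pzRingType.

Definition exact_at (M N P : lmodType R)
    (f : {linear M -> N}) (g : {linear N -> P}) : Prop :=
  forall y : N, g y = 0 <-> exists x : M, f x = y.

Definition right_exact (M N P : lmodType R)
    (f : {linear M -> N}) (g : {linear N -> P}) : Prop :=
  exact_at f g /\ forall z : P, exists y : N, g y = z.

Definition finitely_generated (M : lmodType R) : Prop :=
  exists (n : nat) (e : 'I_n -> M),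
    forall x : M, exists c : 'I_n -> R, x = \sum_i c i *: e i.

Definition finitely_presented (M : lmodType R) : Prop :=
  exists (m n : nat) (f : {linear 'rV[R]_m -> 'rV[R]_n})
    (g : {linear 'rV[R]_n -> M}), right_exact f g.

End Finiteness.

Section RankFunctions.
Variables (R : pzRingType) (K : realType).

(* A rank function is defined on finitely presented modules only; here dim is
   total and its values on other modules are unconstrained. *)
Record sylvester_module_rank (dim : lmodType R -> K) : Prop := {
  smr_ge0 : forall M, finitely_presented M -> 0 <= dim M;
  smr_zero : dim 'rV[R]_0 = 0;
  smr_one : dim R^o = 1;
  smr_sum : forall M N : lmodType R,
    finitely_presented M -> finitely_presented N ->
    dim (M * N)%type = dim M + dim N;
  smr_exact : forall (M1 M2 M3 : lmodType R)
      (f : {linear M1 -> M2}) (g : {linear M2 -> M3}),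
    finitely_presented M1 -> finitely_presented M2 -> finitely_presented M3 ->
    right_exact f g ->
    dim M3 <= dim M2 <= dim M1 + dim M3
}.

(* dim M S stands for dim(S | M). *)
Definition bivariant_fun : Type :=
  forall M : lmodType R, submodClosed M -> \bar K.

Definition bivariant_diag (dim : bivariant_fun) (M : lmodType R) : \bar K :=
  dim M (@submodT R M).

Local Open Scope classical_set_scope.
Local Open Scope ereal_scope.

Record bivariant_sylvester_module_rank (dim : bivariant_fun) : Prop := {
  bsmr_ge0 : forall (M : lmodType R) (S : submodClosed M), 0 <= dim M S;
  bsmr_iso : forall (M N : lmodType R)
      (S : submodClosed M) (T : submodClosed N) (phi : {linear M -> N}),
    bijective phi -> (forall x, (phi x \in T) = (x \in S)) ->
    dim M S = dim N T;
  bsmr_zero : bivariant_diag dim 'rV[R]_0 = 0;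
  bsmr_one : bivariant_diag dim R^o = 1;
  bsmr_sum : forall (M N : lmodType R)
      (S : submodClosed M) (T : submodClosed N),
    dim (M * N)%type (submod_prod S T) = dim M S + dim N T;
  bsmr_sup : forall (M : lmodType R) (S : submodClosed M),
    dim M S = ereal_sup [set dim M S' | S' in
      [set S' : submodClosed M |
        finitely_generated (submod S') /\ {subset S' <= S}]];
  bsmr_inf : forall (M : lmodType R) (S : submodClosed M),
    finitely_generated (submod S) ->
    dim M S = ereal_inf [set dim (submod T) (submod_in S T) | T in
      [set T : submodClosed M |
        finitely_generated (submod T) /\ {subset S <= T}]];
  bsmr_quot : forall (M : lmodType R) (S : submodClosed M),
    bivariant_diag dim M = dim M S + bivariant_diag dim (quotmod S)
}.

Definition extends_rank (dim : lmodType R -> K) (bdim : bivariant_fun) : Prop :=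
  forall M : lmodType R, finitely_presented M -> bivariant_diag bdim M = (dim M)%:E.

End RankFunctions.

(* Main.v *)
(* For a finite family xs in M, let the rank of xs in M be the infimum of
   dim P - dim Q over the surjections P -> Q of finitely presented modules and
   the maps P -> M under which the kernel of P -> Q reaches every member of xs.
   The bivariant function is dim(S | M) := sup of the ranks of the finite
   families in S. Everything rests on additivity along a quotient map
   h : M -> M / S. If s lies in S and P -> Q is admissible for s ++ xs, it
   factors as P -> P / s -> Q, whose steps are admissible for s in M and for
   h xs in M / S. Conversely, an admissible surjection for h xs uses only
   finitely many elements s of S, and it can be glued to any admissible
   surjection for s.

   Uniqueness: condition (6) determines dim(S | M) first for S finitely
   generated and M finitely presented, then (4), (6) and a free cover determine
   dim M for M finitely generated, hence dim(S | M) for such M, and (5) and (4)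
   give the general case. *)

Require Import Defs.
From HB Require Import structures.
From mathcomp Require Import all_boot all_order all_algebra.
From mathcomp Require Import all_classical all_reals ereal.

Set Implicit Arguments.
Unset Strict Implicit.
Unset Printing Implicit Defensive.

Import Order.TTheory GRing.Theory Num.Theory.
Local Open Scope ring_scope.

(** * Linear maps, images, kernels and quotients *)

Section LinearMaps.
Variable R : pzRingType.
Implicit Types L M N P Q : lmodType R.

Definition surjective (A B : Type) (f : A -> B) := forall y, exists x, f x = y.

Lemma inj_surj_bijective (A B : choiceType) (f : A -> B) :
  injective f -> surjective f -> bijective f.
Proof.
by move=> fi fs; have [g gK] := choice fs; exists g => // x; apply: fi; rewrite gK.
Qed.

Definition mk_linear M N (f : M -> N) (fl : linear f) : {linear M -> N} :=
  HB.pack f (GRing.isLinear.Build R M N *:%R f fl).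

Fact pair_linear_subproof L M N (f : {linear L -> M}) (g : {linear L -> N}) :
  linear (fun x => (f x, g x) : (M * N)%type).
Proof. by move=> a x y; rewrite !linearP. Qed.

Definition pair_linear L M N (f : {linear L -> M}) (g : {linear L -> N}) :=
  mk_linear (pair_linear_subproof f g).

Fact copair_linear_subproof L M N (f : {linear L -> N}) (g : {linear M -> N}) :
  linear (fun x : (L * M)%type => f x.1 + g x.2).
Proof.
by move=> a x y; rewrite !linearP /= scalerDr addrACA.
Qed.

Definition copair_linear L M N (f : {linear L -> N}) (g : {linear M -> N}) :=
  mk_linear (copair_linear_subproof f g).

Definition prod_linear L M N P (f : {linear L -> N}) (g : {linear M -> P}) :
    {linear (L * M)%type -> (N * P)%type} :=
  pair_linear (f \o fst) (g \o snd).

Fact free_linear_subproof M n (e : 'I_n -> M) :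
  linear (fun v : 'rV[R]_n => \sum_i v 0 i *: e i).
Proof.
move=> a u v; rewrite scaler_sumr -big_split; apply: eq_bigr => i _ /=.
by rewrite !mxE scalerDl scalerA.
Qed.

Definition free_linear M n (e : 'I_n -> M) := mk_linear (free_linear_subproof e).

Lemma free_linear_delta M n (e : 'I_n -> M) i :
  free_linear e (delta_mx 0 i) = e i.
Proof.
rewrite /= (bigD1 i)//= big1 => [|j ji]; rewrite !mxE ?eqxx ?scale1r ?addr0//.
by rewrite (negPf ji) andbF scale0r.
Qed.

Lemma eq_free_linear M n (f g : {linear 'rV[R]_n -> M}) :
  (forall i, f (delta_mx 0 i) = g (delta_mx 0 i)) -> f =1 g.
Proof.
move=> fg v; rewrite (row_sum_delta v) !linear_sum; apply: eq_bigr => i _.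
by rewrite !linearZ/= fg.
Qed.

(** Projectivity of free modules. Preimages are required over the basis images only, so that [h] may
    fail to be onto; this is how lifts into the kernel of a map are obtained below, with [h] a pair
    of maps. *)
Lemma free_lift M N n (h : {linear M -> N}) (k : {linear 'rV[R]_n -> N}) :
  (forall i, exists x, h x = k (delta_mx 0 i)) ->
  exists l : {linear 'rV[R]_n -> M}, forall v, h (l v) = k v.
Proof.
move=> /choice[e he]; exists (free_linear e).
apply: (eq_free_linear (f := h \o free_linear e)) => i.
by rewrite [LHS]/= -[X in h X]/(free_linear e _) free_linear_delta.
Qed.

(** Two preimages under [g] differ by an element of the image of [f], which [k] kills. Hence
    [k \o s] is independent of the set-theoretic section [s] of [g], and linearity follows. *)
Lemma cokernel_factor L M N P (f : {linear L -> M}) (g : {linear M -> N})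
    (k : {linear M -> P}) :
  right_exact f g -> (forall x, k (f x) = 0) ->
  exists l : {linear N -> P}, forall y, l (g y) = k y.
Proof.
move=> [fg gs] kf; have [s sg] := choice gs.
have lE y : k (s (g y)) = k y.
  apply/eqP; rewrite -subr_eq0 -linearB; apply/eqP.
  have [x <-] : exists x, f x = s (g y) - y by apply/fg; rewrite linearB sg subrr.
  exact: kf.
have ll : linear (k \o s).
  move=> a x y /=.
  have -> : a *: x + y = g (a *: s x + s y) by rewrite linearP !sg.
  by rewrite lE linearP.
by exists (mk_linear ll).
Qed.

Fact inclusion_subproof M (S : submodClosed M) : linear (val : submod S -> M).
Proof. by move=> a x y; rewrite linearP. Qed.

Definition inclusion M (S : submodClosed M) := mk_linear (@inclusion_subproof M S).

Lemma corestriction M N (T : submodClosed N) (f : {linear M -> N}) :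
  (forall x, f x \in T) ->
  exists c : {linear M -> submod T}, forall x, val (c x) = f x.
Proof.
move=> fT; have cl : linear (fun x => Sub (f x) (fT x) : submod T).
  move=> a x y; apply: val_inj.
  by rewrite /= linearP.
by exists (mk_linear cl) => x; rewrite SubK.
Qed.

Section Image.
Variables (M N : lmodType R) (f : {linear M -> N}).

Definition image_pred : {pred N} := [pred y | `[< exists x, f x = y >]].

Lemma image_predP y : reflect (exists x, f x = y) (y \in image_pred).
Proof. exact: asboolP. Qed.

Fact image_pred_closed : submod_closed image_pred.
Proof.
split=> [|a x y]; first by apply/image_predP; exists 0; rewrite linear0.
move=> /image_predP[u <-] /image_predP[v <-].
by apply/image_predP; exists (a *: u + v); rewrite linearP.
Qed.

HB.instance Definition _ :=
  GRing.isSubmodClosed.Build R N image_pred image_pred_closed.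

Definition image_submod : submodClosed N := image_pred.

Lemma image_submodP y : reflect (exists x, f x = y) (y \in image_submod).
Proof. exact: image_predP. Qed.

End Image.

Section Kernel.
Variables (M N : lmodType R) (f : {linear M -> N}).

Definition ker_pred : {pred M} := [pred x | f x == 0].

Fact ker_pred_closed : submod_closed ker_pred.
Proof.
split=> [|a x y]; rewrite !inE ?linear0// => /eqP fx /eqP fy.
by rewrite linearP fx fy scaler0 addr0.
Qed.

HB.instance Definition _ :=
  GRing.isSubmodClosed.Build R M ker_pred ker_pred_closed.

Definition ker_submod : submodClosed M := ker_pred.

Lemma ker_submodP x : reflect (f x = 0) (x \in ker_submod).
Proof. exact: eqP. Qed.

End Kernel.

Section Projection.
Variables (M : lmodType R) (S : submodClosed M).

Fact quotmod_proj_linear : linear (@quotmod_proj R M S).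
Proof.
by move=> a x y; rewrite quotmod_projD -quotmod_projZ.
Qed.

Definition quot_linear := mk_linear quotmod_proj_linear.

Lemma quot_linear_surj : surjective quot_linear.
Proof.
by move=> u; exists (repr (u : Quotient.quot (submod_pred S)));
  apply: quotmod_projK.
Qed.

Lemma quot_linear_eq0 x : quot_linear x = 0 <-> x \in S.
Proof.
have q0 : quotmod_proj S 0 = 0 := linear0 quot_linear.
by rewrite -[x in x \in S]subr0 quotmod_eq q0; split=> /eqP.
Qed.

End Projection.

(** First isomorphism theorem. It lets uniqueness pass from free modules to finitely generated
    ones. *)
Lemma quotmod_ker_iso M N (f : {linear M -> N}) : surjective f ->
  exists phi : {linear quotmod (ker_submod f) -> N}, bijective phi.
Proof.
move=> fs.
have ex : right_exact (inclusion (ker_submod f)) (quot_linear (ker_submod f)).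
  split=> [y|]; last exact: quot_linear_surj.
  rewrite quot_linear_eq0; split=> [yS|[x <-]]; last exact: valP.
  by exists (Sub y yS).
have [|phi phiE] := cokernel_factor (k := f) ex.
  by move=> x; apply/ker_submodP/valP.
exists phi; apply: inj_surj_bijective => [u v|y]; last first.
  by have [x <-] := fs y; exists (quot_linear (ker_submod f) x).
have [x <-] := quot_linear_surj u; have [y <-] := quot_linear_surj v.
rewrite !phiE => fxy; apply/eqP; rewrite -subr_eq0 -linearB; apply/eqP.
by apply/quot_linear_eq0/ker_submodP; rewrite linearB fxy subrr.
Qed.

Lemma right_exact_image M N (f : {linear M -> N}) :
  right_exact f (quot_linear (image_submod f)).
Proof.
split=> [y|]; last exact: quot_linear_surj.
split=> [/quot_linear_eq0/image_submodP//|fy].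
exact/quot_linear_eq0/image_submodP.
Qed.

End LinearMaps.

(** * Finitely generated and finitely presented modules *)

Section FinitePresentation.
Variable R : pzRingType.
Implicit Types L M N P Q : lmodType R.

Lemma fg_cover M : finitely_generated M ->
  exists n (u : {linear 'rV[R]_n -> M}), surjective u.
Proof.
move=> [n [e eM]]; exists n, (free_linear e) => x; have [c ->] := eM x.
by exists (\row_i c i); apply: eq_bigr => i _; rewrite mxE.
Qed.

Lemma cover_fg M n (u : {linear 'rV[R]_n -> M}) : surjective u ->
  finitely_generated M.
Proof.
move=> us; exists n, (fun i => u (delta_mx 0 i)) => x; have [v <-] := us x.
exists (v 0); rewrite [in LHS](row_sum_delta v) linear_sum.
by apply: eq_bigr => i _; rewrite linearZ.
Qed.

Lemma fp_cover M : finitely_presented M ->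
  exists n (u : {linear 'rV[R]_n -> M}), surjective u.
Proof. by move=> [m [n [f [g [_ gs]]]]]; exists n, g. Qed.

Lemma fp_free n : finitely_presented 'rV[R]_n.
Proof.
exists 0%N, n, \0, idfun; split=> [y|z]; last by exists z.
by split=> [/= ->|[x <-]//]; exists 0.
Qed.

Lemma fp_regular : finitely_presented R^o.
Proof.
have pl : linear (fun v : 'rV[R]_1 => v 0 0 : R^o).
  by move=> a u v; rewrite !mxE.
exists 0%N, 1%N, \0, (mk_linear pl); split=> [y|z].
  split=> [/= y0|[x <-]]; last by rewrite linear0.
  by exists 0; apply/rowP => i; rewrite (ord1 i) y0 !mxE.
by exists (const_mx z); rewrite /= mxE.
Qed.

Lemma fp_prod M N : finitely_presented M -> finitely_presented N ->
  finitely_presented (M * N)%type.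
Proof.
move=> [m [n [f [g [fg gs]]]]] [m' [n' [f' [g' [fg' gs']]]]].
have Fl : linear (fun u : 'rV[R]_(m + m') =>
    row_mx (f (lsubmx u)) (f' (rsubmx u))).
  by move=> a u v; rewrite !linearP scale_row_mx add_row_mx.
have Gl : linear (fun u : 'rV[R]_(n + n') =>
    (g (lsubmx u), g' (rsubmx u)) : (M * N)%type).
  by move=> a u v; rewrite !linearP.
exists (m + m')%N, (n + n')%N, (mk_linear Fl), (mk_linear Gl); split=> [y|[z z']].
  split=> /=.
    move=> [/fg[x xE] /fg'[x' xE']]; exists (row_mx x x').
    by rewrite row_mxKl row_mxKr xE xE' hsubmxK.
  move=> [x <-]; rewrite row_mxKl row_mxKr; congr pair.
    by apply/fg; exists (lsubmx x).
  by apply/fg'; exists (rsubmx x).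
have [y <-] := gs z; have [y' <-] := gs' z'.
by exists (row_mx y y'); rewrite /= row_mxKl row_mxKr.
Qed.

(** The generators of [P] also generate [Q]; the relations are those of [P] together with lifts [t]
    of the images under [f] of the [k] basis vectors. *)
Lemma fp_coker P Q k (f : {linear 'rV[R]_k -> P}) (g : {linear P -> Q}) :
  finitely_presented P -> right_exact f g -> finitely_presented Q.
Proof.
move=> [m [n [r [p [rp ps]]]]] [fg gs].
have [|t tE] := @free_lift _ _ _ _ p f; first by move=> i; apply: ps.
have Fl : linear (fun u : 'rV[R]_(m + k) => r (lsubmx u) + t (rsubmx u)).
  by move=> a u v; rewrite !linearP scalerDr addrACA.
exists (m + k)%N, n, (mk_linear Fl), (g \o p); split=> [y|z] /=.
  split=> [/fg[x xE]|[x <-]].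
    have /rp[w wE] : p (y - t x) = 0 by rewrite linearB tE xE subrr.
    by exists (row_mx w x); rewrite row_mxKl row_mxKr wE subrK.
  have pr0 : p (r (lsubmx x)) = 0 by apply/rp; exists (lsubmx x).
  by rewrite linearD pr0 add0r tE; apply/fg; exists (rsubmx x).
by have [y <-] := gs z; have [x <-] := ps y; exists x.
Qed.

Lemma fp_quotmod P (S : submodClosed P) : finitely_presented P ->
  finitely_generated (submod S) -> finitely_presented (quotmod S).
Proof.
move=> Pfp /fg_cover[n [u us]].
apply: (@fp_coker _ _ _ (inclusion S \o u) (quot_linear S)) => //.
split=> [y|]; last exact: quot_linear_surj.
split=> [/quot_linear_eq0 yS|[x <-]]; last exact/quot_linear_eq0/valP.
by have [x xE] := us (Sub y yS); exists x; rewrite /= xE SubK.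
Qed.

Lemma image_submod_fg M n (f : {linear 'rV[R]_n -> M}) :
  finitely_generated (submod (image_submod f)).
Proof.
have [|c cE] := @corestriction _ _ _ (image_submod f) f.
  by move=> x; apply/image_submodP; exists x.
apply: (@cover_fg _ _ c) => y; have /image_submodP[x xE] := valP y.
by exists x; apply: val_inj; rewrite cE.
Qed.

End FinitePresentation.

(** * Bounding a sum of two suprema in the extended reals *)

Section SumOfSuprema.

Local Open Scope classical_set_scope.
Local Open Scope ereal_scope.

(** For finite [a], nonnegativity and the points [t0], [u0] force all values and the supremum of [g]
    to be finite, so the two suprema can be taken one after the other by subtraction. *)
Lemma lee_sum_sup (K : realType) (T U : Type) (P : set T) (Q : set U)
    (f : T -> \bar K) (g : U -> \bar K) t0 u0 a : P t0 -> Q u0 ->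
  (forall t, P t -> 0 <= f t) -> (forall u, Q u -> 0 <= g u) ->
  (forall t u, P t -> Q u -> f t + g u <= a) ->
  ereal_sup [set f t | t in P] +
  ereal_sup [set g u | u in Q] <= a.
Proof.
move=> Pt0 Qu0 f0 g0 fga; have [->|aoo] := eqVneq a +oo; first by rewrite leey.
have a0 : 0 <= a by apply: le_trans (fga _ _ Pt0 Qu0); rewrite adde_ge0 ?f0 ?g0.
have afin : a \is a fin_num by rewrite ge0_fin_numE// lt_neqAle aoo leey.
have le_fin b : 0 <= b -> b <= a -> b \is a fin_num.
  by move=> b0 ba; rewrite ge0_fin_numE// (le_lt_trans ba)// ltey_eq afin.
have sg t : P t -> f t + ereal_sup [set g u | u in Q] <= a.
  move=> Pt; have ffin : f t \is a fin_num.
    apply: le_fin; first exact: f0.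
    by apply: le_trans (fga _ _ Pt Qu0); rewrite leeDl// g0.
  rewrite addeC -leeBrDr//; apply/ereal_supP => _ [u Qu <-].
  by rewrite leeBrDr// addeC fga.
have gsfin : ereal_sup [set g u | u in Q] \is a fin_num.
  apply: le_fin.
    by apply: le_ereal_sup_tmp; exists (g u0); [exists u0 | exact: g0].
  by apply: le_trans (sg _ Pt0); rewrite leeDr// f0.
rewrite -leeBrDr//; apply/ereal_supP => _ [t Pt <-].
by rewrite leeBrDr// sg.
Qed.

End SumOfSuprema.

(** * Existence: upper bounds for the rank of a finite family *)

Section Existence.
Variables (R : pzRingType) (K : realType) (dim : lmodType R -> K).
Hypothesis hdim : sylvester_module_rank dim.
Implicit Types M N P Q : lmodType R.

(** The kernel of [g] may fail to be finitely presented, so the sequence used is [P -> Q -> 0 -> 0],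
    whose subadditivity bound is the claim. *)
Lemma dim_surj P Q (g : {linear P -> Q}) :
  finitely_presented P -> finitely_presented Q -> surjective g ->
  dim Q <= dim P.
Proof.
move=> Pfp Qfp gs.
have e : right_exact g (\0 : {linear Q -> 'rV[R]_0}).
  by split=> [y|z]; [split=> // _; apply: gs | exists 0; rewrite [RHS]thinmx0].
have /andP[_] := smr_exact hdim Pfp Qfp (@fp_free R 0) e.
by rewrite (smr_zero hdim) addr0.
Qed.

(** By condition (6), [dim P - dim Q] is what the dimension of the kernel of [g] inside [P] must be;
    its image under [phi] contains [xs], so [v] is an upper bound for the dimension of the span of
    [xs] in [M]. *)
Definition rank_bound M (xs : seq M) (v : K) : Prop :=
  exists (P Q : lmodType R) (g : {linear P -> Q}) (phi : {linear P -> M}),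
    [/\ finitely_presented P, finitely_presented Q, surjective g,
        forall x, x \in xs -> exists2 p, g p = 0 & phi p = x
      & v = dim P - dim Q].

Lemma rank_bound_ge0 M (xs : seq M) v : rank_bound xs v -> 0 <= v.
Proof.
by move=> [P [Q [g [phi [Pfp Qfp gs _ ->]]]]]; rewrite subr_ge0 (dim_surj (g := g)).
Qed.

Lemma rank_bound_map M N (h : {linear M -> N}) (xs : seq M) (ys : seq N) v :
  {subset ys <= map h xs} -> rank_bound xs v -> rank_bound ys v.
Proof.
move=> yx [P [Q [g [phi [Pfp Qfp gs xP ->]]]]].
exists P, Q, g, (h \o phi); split=> // y /yx /mapP[x /xP[p gp <-] ->].
by exists p.
Qed.

Lemma rank_bound_prod M N (xs : seq (M * N)%type) v w :
  rank_bound (map fst xs) v -> rank_bound (map snd xs) w ->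
  rank_bound xs (v + w).
Proof.
move=> [P [Q [g [phi [Pfp Qfp gs xP ->]]]]].
move=> [P' [Q' [g' [phi' [Pfp' Qfp' gs' xP' ->]]]]].
exists (P * P')%type, (Q * Q')%type, (prod_linear g g'), (prod_linear phi phi').
split; [exact: fp_prod | exact: fp_prod | | |].
- by move=> [q q']; have [p <-] := gs q; have [p' <-] := gs' q'; exists (p, p').
- move=> x xx; have [p gp px] := xP _ (map_f fst xx).
  have [p' gp' px'] := xP' _ (map_f snd xx).
  by exists (p, p'); rewrite /= ?gp ?gp'// px px' -surjective_pairing.
- by rewrite !(smr_sum hdim)// opprD addrACA.
Qed.

(** The surjection is cut at the quotient of [P] by finitely many kernel elements [e] lying over
    [s]. Finitely many relations keep this quotient finitely presented, and the two differences of
    dimensions telescope. *)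
Lemma rank_bound_split M N (h : {linear M -> N}) (s xs : seq M) v :
  (forall x, x \in s -> h x = 0) -> rank_bound (s ++ xs) v ->
  exists v1 v2, [/\ rank_bound s v1, rank_bound (map h xs) v2 & v = v1 + v2].
Proof.
move=> hs [P [Q [g [phi [Pfp Qfp gs xP ->]]]]].
have /choice[e eE] : forall i : 'I_(size s), exists p, g p = 0 /\ phi p = s`_i.
  move=> i; have [|p gp pE] := xP s`_i; last by exists p.
  by rewrite mem_cat mem_nth.
pose F := free_linear e; pose q := quot_linear (image_submod F).
have Fq : right_exact F q := right_exact_image F.
have Q1fp : finitely_presented (quotmod (image_submod F)) := fp_coker Pfp Fq.
have qF x : q (F x) = 0 by apply/Fq.1; exists x.
(* Both [g] and [h \o phi] descend to the quotient: the former because each [e i] lies in the kernel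
   of [g], the latter because [h] kills [s]. *)
have [|g1 g1E] := cokernel_factor (k := g) Fq.
  apply: (eq_free_linear (f := g \o F) (g := \0)) => i.
  by rewrite [LHS]/= -[X in g X]/(F _) free_linear_delta (eE i).1.
have [|phi1 phi1E] := cokernel_factor (k := h \o phi) Fq.
  apply: (eq_free_linear (f := h \o (phi \o F)) (g := \0)) => i.
  rewrite [LHS]/= -[X in phi X]/(F _) free_linear_delta (eE i).2 hs//.
  by rewrite mem_nth.
exists (dim P - dim (quotmod (image_submod F))),
  (dim (quotmod (image_submod F)) - dim Q).
split; last by rewrite addrA subrK.
- exists P, (quotmod (image_submod F)), q, phi; split=> //.
    exact: quot_linear_surj.
  move=> x xs'; have ix : (index x s < size s)%N by rewrite index_mem.
  exists (e (Ordinal ix)); last by rewrite (eE _).2 nth_index.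
  by rewrite -(free_linear_delta e) qF.
- exists (quotmod (image_submod F)), Q, g1, phi1; split=> //.
    by move=> z; have [y <-] := gs z; exists (q y).
  move=> _ /mapP[x xx ->]; have [|p gp px] := xP x.
    by rewrite mem_cat xx orbT.
  by exists (q p); rewrite ?g1E ?phi1E//= px.
Qed.

(** The family [s] is chosen from the surjection for [map h xs] alone, before [v]; this order of
    quantifiers later allows the infimum over [v] with [s] fixed. *)
Lemma rank_bound_extension M N (h : {linear M -> N}) (S : submodClosed M)
    (xs : seq M) v' :
  surjective h -> (forall x, h x = 0 -> x \in S) ->
  rank_bound (map h xs) v' ->
  exists2 s : seq M, {subset s <= S} &
    forall v, rank_bound s v ->
    exists2 w, w <= v + v' & rank_bound xs w.
Proof.
move=> hs hS [P' [Q' [g' [phi' [Pfp' Qfp' gs' xP' ->]]]]].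
have [m [n [r [p [rp ps]]]]] := Pfp'.
have [|psi psiE] := @free_lift _ _ _ _ h (phi' \o p); first by move=> i; apply: hs.
(* For [x] in [xs], [u x] lifts to the free cover of [P'] a kernel element of [g'] lying over [h x];
   the value 0 elsewhere is arbitrary. *)
have /choice[u uE] : forall x, exists u : 'rV[R]_n, x \in xs ->
    g' (p u) = 0 /\ h (psi u) = h x.
  move=> x; have [xx|] := boolP (x \in xs); last by exists 0.
  have [y gy yE] := xP' _ (map_f h xx); have [u uy] := ps y.
  by exists u => _; rewrite psiE /= uy.
(* [s] records how far [psi] is from solving the problem in [M]: the images of the relations of
   [P'], and the errors [x - psi (u x)]. All of them are killed by [h]. *)
exists ([seq psi (r (delta_mx 0 i)) | i <- enum 'I_m] ++
        [seq x - psi (u x) | x <- xs]).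
  move=> y; rewrite mem_cat => /orP[/mapP[i _ ->]|/mapP[x xx ->]]; apply: hS.
    by rewrite psiE /= (_ : p _ = 0) ?linear0//; apply/rp; eexists.
  by rewrite linearB (uE x xx).2 subrr.
move=> _ [P [Q [g [phi [Pfp Qfp gs xP ->]]]]].
(* Admissibility for the first half of [s] gives, for each relation of [P'], an element of the
   kernel of [g] with the same image in [M]. *)
have [|z zE] := @free_lift _ _ _ _ (pair_linear g phi) (pair_linear \0 (psi \o r)).
  move=> i; have [|a ga aE] := xP (psi (r (delta_mx 0 i))).
    by rewrite mem_cat; apply/orP; left; apply/mapP; exists i; rewrite ?mem_enum.
  by exists a; rewrite /= ga aE.
have gz x : g (z x) = 0 by have [] := zE x.
have phiz x : phi (z x) = psi (r x) by have [] := zE x.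
(* W glues P to a free cover of P' along the relations of P', so that
   P -> W -> P' -> 0 is exact and W maps onto Q * Q'. *)
pose F := pair_linear (\- z) r : {linear _ -> (P * 'rV[R]_n)%type}.
pose W := quotmod (image_submod F); pose om := quot_linear (image_submod F).
have Fom : right_exact F om := right_exact_image F.
have Wfp : finitely_presented W.
  by apply: fp_coker Fom; apply: fp_prod => //; apply: fp_free.
have [|th thE] := cokernel_factor (k := copair_linear phi psi) Fom.
  by move=> x; rewrite /= linearN phiz addNr.
have [|G GE] := cokernel_factor (k := prod_linear g (g' \o p)) Fom.
  move=> x; rewrite /= linearN gz oppr0 (_ : p (r x) = 0) ?linear0//.
  by apply/rp; exists x.
have [|pr prE] := cokernel_factor (k := p \o snd) Fom.
  by move=> x; apply/rp; exists x.
have incl : linear (fun a : P => om (a, 0)).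
  move=> b x y; rewrite -linearP; congr (om _).
  by rewrite [RHS]surjective_pairing /= scaler0 addr0.
have Wle : dim W <= dim P + dim P'.
  have ex : right_exact (mk_linear incl) pr.
    split=> [w|y]; last by have [x <-] := ps y; exists (om (0, x)); rewrite prE.
    split=> [|[a <-]]; last by rewrite /= prE /= linear0.
    have [[a x] <-] := Fom.2 w; rewrite prE /= => /rp[c <-].
    (* In [W] the relation [r c] is identified with [z c], so [(a, r c)] has the same class as
       [(a + z c, 0)]. *)
    exists (a + z c); suff : om ((a + z c, 0) - (a, r c)) = 0.
      by rewrite linearB => /eqP; rewrite subr_eq0 => /eqP.
    apply/Fom.1; exists (- c); rewrite /= !linearN opprK.
    by congr pair; rewrite /= ?sub0r// addrAC subrr add0r.
  by have /andP[] := smr_exact hdim Pfp Wfp Pfp' ex.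
exists (dim W - dim (Q * Q')%type).
  by rewrite (smr_sum hdim)// opprD [leRHS]addrACA lerD2r.
exists W, (Q * Q')%type, G, th; split=> //; first exact: fp_prod.
  move=> [a b]; have [a' <-] := gs a; have [b' <-] := gs' b.
  by have [b'' <-] := ps b'; exists (om (a', b'')); rewrite GE.
move=> x xx; have [|a ga aE] := xP (x - psi (u x)).
  by rewrite mem_cat; apply/orP; right; apply/mapP; exists x.
(* [a] supplies the error [x - psi (u x)] and [u x] supplies [psi (u x)]; both components die in
   [Q * Q']. *)
exists (om (a, u x)); first by rewrite GE /= ga (uE x xx).1.
by rewrite thE /= aE subrK.
Qed.

(** * The bivariant function and its axioms *)

Local Open Scope classical_set_scope.
Local Open Scope ereal_scope.

Definition rank M (xs : seq M) : \bar K :=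
  ereal_inf [set v%:E | v in [set v | rank_bound xs v]].

Definition bidim : bivariant_fun R K := fun M S =>
  ereal_sup [set rank xs | xs in [set xs | {subset xs <= S}]].

Lemma rank_le M (xs : seq M) v : rank_bound xs v -> rank xs <= v%:E.
Proof. by move=> xv; apply: ereal_inf_lbound; exists v. Qed.

Lemma le_rank M (xs : seq M) a :
  (forall v, rank_bound xs v -> a <= v%:E) -> a <= rank xs.
Proof. by move=> ax; apply/ereal_infP => _ [v /ax av <-]. Qed.

Lemma rank_ge0 M (xs : seq M) : 0 <= rank xs.
Proof. by apply: le_rank => v /rank_bound_ge0. Qed.

Lemma rank_le_bidim M (S : submodClosed M) (xs : seq M) :
  {subset xs <= S} -> rank xs <= bidim S.
Proof. by move=> xS; apply: ereal_sup_ubound; exists xs. Qed.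

Lemma bidim_le M (S : submodClosed M) a :
  (forall xs : seq M, {subset xs <= S} -> rank xs <= a) -> bidim S <= a.
Proof. by move=> Sa; apply/ereal_supP => _ [xs /Sa xa <-]. Qed.

Lemma nil_subset M (S : submodClosed M) : {subset [::] <= S}.
Proof. by move=> x; rewrite in_nil. Qed.

Lemma bidim_ge0 M (S : submodClosed M) : 0 <= bidim S.
Proof. exact: le_trans (rank_ge0 [::]) (rank_le_bidim (nil_subset S)). Qed.

Lemma rank_map M N (h : {linear M -> N}) (xs : seq M) (ys : seq N) :
  {subset ys <= map h xs} -> rank ys <= rank xs.
Proof.
by move=> yx; apply: le_rank => v xv; apply/rank_le/(rank_bound_map yx).
Qed.

(** Monotonicity in the submodule, isomorphism invariance and the comparison of [S] inside [T] with
    [S] inside [M] are all instances. *)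
Lemma bidim_map M N (h : {linear M -> N})
    (S : submodClosed M) (T : submodClosed N) :
  (forall y, y \in T -> exists2 x, x \in S & h x = y) -> bidim T <= bidim S.
Proof.
move=> hST; apply: bidim_le => ys yT.
have /choice[c cE] : forall y, exists x, y \in T -> x \in S /\ h x = y.
  move=> y; have [/hST[x xS xE]|] := boolP (y \in T); first by exists x.
  by exists 0%R.
apply: (@le_trans _ _ (rank (map c ys))).
  apply: (rank_map (h := h)) => y yy; apply/mapP; exists (c y).
    exact: map_f.
  by rewrite (cE y (yT _ yy)).2.
by apply: rank_le_bidim => _ /mapP[y yy ->]; rewrite (cE y (yT _ yy)).1.
Qed.

Lemma rankD_le M N (h : {linear M -> N}) (s xs : seq M) :
  (forall x, x \in s -> h x = 0%R) ->
  rank s + rank (map h xs) <= rank (s ++ xs).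
Proof.
move=> hs; apply: le_rank => v /(rank_bound_split hs)[v1 [v2 [b1 b2 ->]]].
by rewrite EFinD leeD// rank_le.
Qed.

Lemma bidim_sum M N (S : submodClosed M) (T : submodClosed N) :
  bidim (submod_prod S T) = bidim S + bidim T.
Proof.
apply/eqP; rewrite eq_le; apply/andP; split.
  apply: bidim_le => xs xsST.
  have xS : {subset map fst xs <= S}.
    by move=> _ /mapP[x /xsST/andP[xS _] ->].
  have xT : {subset map snd xs <= T}.
    by move=> _ /mapP[x /xsST/andP[_ xT] ->].
  apply: le_trans (leeD (rank_le_bidim xS) (rank_le_bidim xT)).
  (* An infinite rank makes the right side [+oo]; otherwise the two infima are taken in turn by
     subtraction. *)
  have [/eqP y|xfin] := boolP (rank (map fst xs) == +oo).
    by rewrite y addye ?leey// gt_eqF// (lt_le_trans _ (rank_ge0 _)).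
  have {}xfin : rank (map fst xs) \is a fin_num.
    by rewrite ge0_fin_numE ?rank_ge0// lt_neqAle xfin leey.
  rewrite -leeBlDl//; apply: le_rank => w xw.
  rewrite leeBlDr// -leeBlDl//; apply: le_rank => v xv.
  by rewrite leeBlDr// -EFinD; apply: rank_le; apply: rank_bound_prod.
apply: (lee_sum_sup (t0 := [::]) (u0 := [::])).
- exact: nil_subset.
- exact: nil_subset.
- by move=> xs _; apply: rank_ge0.
- by move=> xs _; apply: rank_ge0.
move=> s t sS tT.
pose inl := pair_linear (idfun : {linear M -> M}) (\0 : {linear M -> N}).
pose inr := pair_linear (\0 : {linear N -> M}) (idfun : {linear N -> N}).
have st : {subset map inl s ++ map inr t <= submod_prod S T}.
  move=> x; rewrite mem_cat => /orP[] /mapP[y yy ->].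
    by rewrite inE /= sS// rpred0.
  by rewrite inE /= tT// rpred0.
apply: le_trans (rank_le_bidim st).
(* The second projection kills [map inl s] and recovers [t] from [map inr t], so superadditivity
   along it applies. *)
have snd0 x : x \in map inl s -> snd x = 0%R by move=> /mapP[y _ ->].
apply: le_trans (rankD_le (h := snd) _ snd0); apply: leeD.
  by apply: (rank_map (h := fst)) => x; rewrite -map_comp map_id_in.
by apply: (rank_map (h := idfun)) => x; rewrite map_id -map_comp map_id_in.
Qed.

Lemma bidim_quot M (S : submodClosed M) :
  bivariant_diag bidim M = bidim S + bivariant_diag bidim (quotmod S).
Proof.
apply/eqP; rewrite eq_le; apply/andP; split.
  apply: bidim_le => xs _.
  have [->|Sfin] := eqVneq (bidim S) +oo.
    by rewrite addye ?leey// gt_eqF// (lt_le_trans _ (bidim_ge0 _)).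
  have {}Sfin : bidim S \is a fin_num.
    by rewrite ge0_fin_numE ?bidim_ge0// lt_neqAle Sfin leey.
  apply: (@le_trans _ _ (bidim S + rank (map (quot_linear S) xs))); last first.
    by rewrite leeD2l// rank_le_bidim.
  rewrite -leeBlDl//; apply: le_rank => v' xv'.
  (* With [v'] fixed, [bidim S] dominates the rank of this [s], and each bound for [s] yields one
     for [xs]. *)
  have [s sS sP] := rank_bound_extension (@quot_linear_surj _ _ S)
    (fun x => (quot_linear_eq0 S x).1) xv'.
  rewrite leeBlDl// -leeBlDr//.
  apply: le_trans (rank_le_bidim sS); apply: le_rank => v /sP[w wv xw].
  by rewrite leeBlDr// -EFinD; apply: le_trans (rank_le xw) _; rewrite lee_fin.
apply: (lee_sum_sup (t0 := [::]) (u0 := [::])).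
- exact: nil_subset.
- exact: nil_subset.
- by move=> xs _; apply: rank_ge0.
- by move=> xs _; apply: rank_ge0.
move=> s t sS _; have [r rE] := choice (@quot_linear_surj _ _ S).
have s0 x : x \in s -> quot_linear S x = 0%R by move=> /sS xS; apply/quot_linear_eq0.
rewrite -[t](mapK (g := quot_linear S) (f := r))//.
apply: le_trans (rankD_le (map r t) s0) _.
exact: rank_le_bidim.
Qed.

(** Every finite family in [S] lies in its own span, a finitely generated submodule of [S]. *)
Lemma bidim_sup M (S : submodClosed M) :
  bidim S = ereal_sup [set bidim S' | S' in
    [set S' : submodClosed M |
      finitely_generated (submod S') /\ {subset S' <= S}]].
Proof.
apply/eqP; rewrite eq_le; apply/andP; split; last first.
  apply/ereal_supP => _ [S' [_ S'S] <-].
  by apply: (bidim_map (h := idfun)) => x /S'S xS; exists x.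
apply: bidim_le => xs xS; pose F := free_linear (fun i : 'I_(size xs) => xs`_i).
apply: le_ereal_sup_tmp; exists (bidim (image_submod F)).
  exists (image_submod F) => //; split; first exact: image_submod_fg.
  move=> _ /image_submodP[c <-]; apply: rpred_sum => i _; apply: rpredZ.
  by apply: xS; rewrite mem_nth.
apply: rank_le_bidim => x xx.
have ix : (index x xs < size xs)%N by rewrite index_mem.
apply/image_submodP; exists (delta_mx 0%R (Ordinal ix)).
by rewrite free_linear_delta nth_index.
Qed.

(** One inequality is [bidim_map] for the inclusion of [T]. For the other, given an admissible
    surjection for generators of [S], the image [T] of [phi] is finitely generated, and
    corestricting [phi] to [T] keeps the value [v] while serving every family in [S]. *)
Lemma bidim_inf M (S : submodClosed M) : finitely_generated (submod S) ->
  bidim S = ereal_inf [set bidim (submod_in S T) | T in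
    [set T : submodClosed M |
      finitely_generated (submod T) /\ {subset S <= T}]].
Proof.
move=> [n [e eS]]; apply/eqP; rewrite eq_le; apply/andP; split.
  apply/ereal_infP => _ [T [_ ST] <-].
  apply: (bidim_map (h := inclusion T)) => x xS.
  by exists (Sub x (ST _ xS)); rewrite ?inE /= ?SubK.
have eeS : {subset codom (val \o e) <= S} by move=> _ /codomP[i ->]; apply: valP.
apply: le_trans (rank_le_bidim eeS).
apply: le_rank => v [P [Q [g [phi [Pfp Qfp gs xP ->]]]]].
have spanS x : x \in S -> exists2 p, g p = 0%R & phi p = x.
  move=> xS; have /choice[a aE] : forall i, exists p, g p = 0%R /\ phi p = val (e i).
    by move=> i; have [|p] := xP (val (e i)); [exact: (codom_f (val \o e)) | exists p].
  have [c cE] := eS (Sub x xS); exists (\sum_i c i *: a i)%R.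
    by rewrite linear_sum big1// => i _; rewrite linearZ/= (aE i).1 scaler0.
  have := congr1 val cE; rewrite SubK => ->; rewrite !linear_sum.
  by apply: eq_bigr => i _; rewrite !linearZ/= (aE i).2.
have [k [u us]] := fp_cover Pfp.
pose T := image_submod (phi \o u).
have phiT p : phi p \in T by have [w <-] := us p; apply/image_submodP; exists w.
have [c cE] := corestriction phiT.
apply: ge_ereal_inf; exists (bidim (submod_in S T)).
  exists T => //; split; first exact: image_submod_fg.
  by move=> x /spanS[p _ <-].
apply: bidim_le => ys yS; apply: rank_le; exists P, Q, g, c; split=> // y /yS.
rewrite inE => /spanS[p gp pE]; exists p => //.
by apply: val_inj; rewrite cE.
Qed.

(** The surjection [M -> 0] gives the upper bound. Conversely, if [P -> Q] is admissible for
    generators of [M], then [P] maps onto [M * Q], whence [dim M + dim Q <= dim P]. *)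
Lemma bidim_extends : extends_rank dim bidim.
Proof.
move=> M Mfp; apply/eqP; rewrite eq_le; apply/andP; split.
  apply: bidim_le => xs _; apply: rank_le.
  exists M, 'rV[R]_0, \0%R, idfun; split=> //; first exact: fp_free.
  - by move=> y; exists 0%R; rewrite [RHS]thinmx0.
  - by move=> x _; exists x.
  by rewrite (smr_zero hdim) subr0.
have [n [u us]] := fp_cover Mfp.
pose xs := [seq u (delta_mx 0%R i) | i <- enum 'I_n].
apply: (@le_trans _ _ (rank xs)); last exact: rank_le_bidim.
apply: le_rank => v [P [Q [g [phi [Pfp Qfp gs xP ->]]]]].
rewrite lee_fin lerBrDr -(smr_sum hdim)//.
apply: (@dim_surj _ _ (pair_linear phi g)) => //; first exact: fp_prod.
have [|z zE] := @free_lift _ _ _ _ (pair_linear phi g) (pair_linear u \0%R).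
  move=> i; have [|p gp pE] := xP (u (delta_mx 0%R i)).
    by apply/mapP; exists i; rewrite ?mem_enum.
  by exists p; rewrite /= pE gp.
move=> [x y]; have [p py] := gs y; have [w wx] := us (x - phi p)%R.
(* [p] gives the second coordinate; [z w] lies in the kernel of [g] and corrects the first by
   [x - phi p]. *)
exists (z w + p)%R; rewrite linearD zE /= wx py.
by congr pair; rewrite /= ?add0r// subrK.
Qed.

Lemma bidim_bivariant : bivariant_sylvester_module_rank bidim.
Proof.
split.
- exact: bidim_ge0.
- move=> M N S T phi phib phiST; apply/eqP; rewrite eq_le; apply/andP.
  have [psi phiK psiK] := phib.
  have psil : linear psi.
    by move=> a x y; apply: (can_inj phiK); rewrite linearP !psiK.
  split.
    by apply: (bidim_map (h := mk_linear psil)) => x xS; exists (phi x);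
      rewrite ?phiST//= phiK.
  by apply: (bidim_map (h := phi)) => y yT; exists (psi y);
      rewrite -?phiST psiK.
- by rewrite bidim_extends ?(smr_zero hdim)//; apply: fp_free.
- by rewrite bidim_extends ?(smr_one hdim)//; apply: fp_regular.
- exact: bidim_sum.
- exact: bidim_sup.
- exact: bidim_inf.
- exact: bidim_quot.
Qed.

End Existence.

(** * Uniqueness of the extension *)

Section Uniqueness.
Variables (R : pzRingType) (K : realType) (dim : lmodType R -> K).
Variables b1 b2 : bivariant_fun R K.
Hypotheses (b1P : bivariant_sylvester_module_rank b1)
           (b2P : bivariant_sylvester_module_rank b2).
Hypotheses (b1dim : extends_rank dim b1) (b2dim : extends_rank dim b2).

Local Open Scope classical_set_scope.
Local Open Scope ereal_scope.

(** Finiteness accompanies equality because condition (6) can be solved for one term only by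
    cancelling a finite one. *)
Definition finite_agree (M : lmodType R) (S : submodClosed M) :=
  b1 S = b2 S /\ b1 S \is a fin_num.

Lemma finite_agree_sub (M : lmodType R) (S : submodClosed M) :
  finite_agree (@submodT R M) -> finite_agree (@submodT R (quotmod S)) ->
  b1 S = b2 S.
Proof.
move=> [Me _] [Qe Qfin].
have := bsmr_quot b2P S; rewrite /bivariant_diag -Me -Qe.
rewrite [LHS](bsmr_quot b1P S) => e.
by rewrite -[LHS](addeK _ Qfin) e addeK.
Qed.

Lemma finite_agree_quot (M : lmodType R) (S : submodClosed M) :
  finite_agree (@submodT R M) -> b1 S = b2 S ->
  finite_agree (@submodT R (quotmod S)).
Proof.
move=> [Me Mfin] Se.
have q1 : b1 (@submodT R M) = b1 S + b1 (@submodT R (quotmod S)) := bsmr_quot b1P S.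
have q2 : b2 (@submodT R M) = b2 S + b2 (@submodT R (quotmod S)) := bsmr_quot b2P S.
have S0 := bsmr_ge0 b1P S; have Q0 := bsmr_ge0 b1P (@submodT R (quotmod S)).
have [Sfin Qfin] : b1 S \is a fin_num /\ b1 (@submodT R (quotmod S)) \is a fin_num.
  by apply/andP; rewrite -fin_numD -q1.
split=> //; rewrite -[LHS](addeK _ Sfin) -[RHS](addeK _ Sfin); congr (_ - _).
by rewrite addeC -q1 Me q2 -Se addeC.
Qed.

Lemma finite_agree_fp (M : lmodType R) :
  finitely_presented M -> finite_agree (@submodT R M).
Proof.
move=> Mfp; split; first by have := b1dim Mfp; rewrite -(b2dim Mfp).
by have := b1dim Mfp; rewrite /bivariant_diag => ->.
Qed.

Lemma agree_sup (M : lmodType R) (S : submodClosed M) :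
  (forall S' : submodClosed M, finitely_generated (submod S') -> b1 S' = b2 S') ->
  b1 S = b2 S.
Proof.
move=> e; rewrite (bsmr_sup b1P) (bsmr_sup b2P); congr ereal_sup.
by apply: eq_imagel => S' [/e ->].
Qed.

(** By condition (4) a finitely generated submodule suffices, and the quotient by it is again
    finitely presented. *)
Lemma agree_fp (M : lmodType R) (S : submodClosed M) :
  finitely_presented M -> b1 S = b2 S.
Proof.
move=> Mfp; apply: agree_sup => S' S'fg.
by apply: finite_agree_sub; apply: finite_agree_fp => //; apply: fp_quotmod.
Qed.

Lemma finite_agree_fg (M : lmodType R) :
  finitely_generated M -> finite_agree (@submodT R M).
Proof.
move=> /fg_cover[n [u /quotmod_ker_iso[phi phib]]].
(* The kernel of a free cover need not be finitely generated; [agree_fp] applies since it covers all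
   submodules. *)
have [e fin] : finite_agree (@submodT R (quotmod (ker_submod u))).
  apply: finite_agree_quot; first exact/finite_agree_fp/fp_free.
  exact/agree_fp/fp_free.
have T x : (phi x \in @submodT R M) = (x \in @submodT R (quotmod (ker_submod u))).
  by [].
by split; rewrite -(bsmr_iso b1P phib T)// -(bsmr_iso b2P phib T).
Qed.

Lemma agree_fg (M : lmodType R) (S : submodClosed M) :
  finitely_generated M -> b1 S = b2 S.
Proof.
move=> Mfg; apply: finite_agree_sub; apply: finite_agree_fg => //.
have [n [u us]] := fg_cover Mfg.
apply: (@cover_fg _ _ _ (quot_linear S \o u)) => y.
by have [x <-] := quot_linear_surj y; have [w <-] := us x; exists w.
Qed.

(** Condition (4) makes the submodule finitely generated, then condition (5) the ambient module. *)
Lemma bivariant_unique : b1 = b2.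
Proof.
apply/functional_extensionality_dep => M; apply/funext => S.
apply: agree_sup => S' S'fg; rewrite (bsmr_inf b1P)// (bsmr_inf b2P)//.
by congr ereal_inf; apply: eq_imagel => T [Tfg _]; apply: agree_fg.
Qed.

End Uniqueness.

Theorem theorem3p3 (R : pzRingType) (K : realType) (dim : lmodType R -> K)
    (hdim : sylvester_module_rank dim) :
  exists! bdim : bivariant_fun R K,
    bivariant_sylvester_module_rank bdim /\ extends_rank dim bdim.
Proof.
exists (bidim dim); split.
  by split; [exact: bidim_bivariant | exact: bidim_extends].
move=> b [bP bdim]; apply: bivariant_unique (bidim_bivariant hdim) bP _ bdim.
exact: bidim_extends.
Qed.
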